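(* Let $\mathcal U$ be a full rank upper cluster algebra (of geometric type) and $t_0$ a seed of $\mathcal U$. Then every non-zero $M\in\mathcal U$ admits a unique local factorization with respect to $t_0$; that is, there is exactly one pair $(N,L)$ such that $M=N\cdot L$, $N$ is a cluster monomial in $t_0$, and $L\in\mathcal U$ satisfies $(A_{k;t_0}\mid\mid L)_v=0$ (equivalently $L/A_{k;t_0}\notin\mathcal U$) for all $k=1,\ldots,n$.
   Context: Throughout, $\mathbb K$ is a factorial domain (UFD) of characteristic $0$. A semifield $(\mathbb P,\oplus,\cdot)$ is an abelian multiplicative group with a commutative, associative operation $\oplus$ over which multiplication distributes; $\mathbb{KP}$ is its group ring over $\mathbb K$, and $\mathcal F$ is the field of rational functions in $n$ independent variables with coefficients in $\mathbb{KP}$. An integer $n\times n$ matrix $B$ is skew-symmetrizable if $SB$ is skew-symmetric for some integer diagonal matrix $S$ with positive diagonal entries. A (labeled) $\mathscr A$-seed over $\mathbb P$ is a triple $(B,X,A)$ with $B=(b_{ij})$ an $n\times n$ skew-symmetrizable integer matrix, $X=(X_1,\ldots,X_n)\in\mathbb P^n$, and $A=(A_1,\ldots,A_n)$ a free generating set of $\mathcal F$ over $\mathbb{KP}$. Its $k$-th exchange binomial is $P_k=\frac{X_k}{1\oplus X_k}\prod_{b_{jk}>0}A_j^{b_{jk}}+\frac{1}{1\oplus X_k}\prod_{b_{jk}<0}A_j^{-b_{jk}}$. The mutation $\mu_k(B,X,A)=(B',X',A')$ is: $b'_{ij}=-b_{ij}$ if $i=k$ or $j=k$, else $b'_{ij}=b_{ij}+\mathrm{sgn}(b_{ik})\max(b_{ik}b_{kj},0)$;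 $X'_k=X_k^{-1}$ and $X'_i=X_iX_k^{\max(b_{ki},0)}(1\oplus X_k)^{-b_{ki}}$ for $i\ne k$; $A'_i=A_i$ for $i\neq k$ and $A'_k=A_k^{-1}P_k$. Let $\mathbb T_n$ be the $n$-regular tree with edges labeled $1,\ldots,n$ so that edges at each vertex have distinct labels. An $\mathscr A$-seed pattern assigns to each vertex $t$ a seed $(B_t,X_t,A_t)$, $B_t=(b^t_{ij})$, $X_t=(X_{1;t},\ldots,X_{n;t})$, $A_t=(A_{1;t},\ldots,A_{n;t})$, such that seeds at vertices joined by an edge labeled $k$ are related by $\mu_k$. A vertex and its seed are denoted by the same letter; one vertex $t_0$ is chosen as initial. The upper cluster algebra is $\mathcal U=\bigcap_{t}\mathcal L(t)$ with $\mathcal L(t)=\mathbb{KP}[A_{1;t}^{\pm1},\ldots,A_{n;t}^{\pm1}]$. The $A_{k;t}$ are the cluster variables (they lie in $\mathcal U$), $A_t$ is the cluster at $t$. A cluster monomial in $t$ is a monomial with non-negative exponents in the variables of $A_t$. Standing assumption: no exchange binomial of $\mathcal U$ is invertible in $\mathbb{KP}$. Geometric type: $\mathbb P=\mathrm{Trop}(Z_1,\ldots,Z_m)$, the free abelian group on $Z_1,\ldots,Z_m$ with $\prod Z_i^{a_i}\oplus\prod Z_i^{b_i}=\prod Z_i^{\min(a_i,b_i)}$. Writing $X_{k;t}=\prod_i Z_i^{c_{ik}^t}$, $C_t=(c_{ij}^t)_{m\times n}$, the extended exchange matrix is the $(n+m)\times n$ matrix $\widetilde B_t=\begin{pmatrix}B_t\\C_t\end{pmatrix}$.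 $\mathcal U$ is full rank if it is of geometric type and $\widetilde B_{t_0}$ has full rank $n$ (then every $\widetilde B_t$ has). Valuation pairing: for a cluster variable $A_{k;t}$ and $M\in\mathcal U$, $(A_{k;t}\mid\mid M)_v:=\max\{s\in\mathbb N\mid M/A_{k;t}^s\in\mathcal U\}\in\mathbb N\cup\{\infty\}$. *)

(* Defs.v *)
From HB Require Import structures.
From mathcomp Require Import all_boot all_order all_algebra.
From mathcomp Require Import boolp.
From mathcomp Require Import mpoly.

Set Implicit Arguments.
Unset Strict Implicit.
Unset Printing Implicit Defensive.

Import Order.TTheory GRing.Theory Num.Theory.
Local Open Scope ring_scope.

Definition irreducible_elt (K : idomainType) (p : K) : Prop :=
  [/\ p != 0, p \isn't a GRing.unit &
      forall a b : K, p = a * b -> a \is a GRing.unit \/ b \is a GRing.unit].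

Definition associate (K : idomainType) (p q : K) : Prop :=
  exists2 u : K, u \is a GRing.unit & p = u * q.

Definition factorial_domain (K : idomainType) : Prop :=
  (forall x : K, x != 0 -> x \isn't a GRing.unit ->
     exists2 s : seq K, (forall p, p \in s -> irreducible_elt p) &
                        x = \prod_(p <- s) p) /\
  (forall s t : seq K,
     (forall p, p \in s -> irreducible_elt p) ->
     (forall p, p \in t -> irreducible_elt p) ->
     \prod_(p <- s) p = \prod_(p <- t) p ->
     exists t' : seq K,
       [/\ perm_eq t t', size s = size t' &
           forall i, (i < size s)%N -> associate s`_i t'`_i]).

(* The element Z_1^{a_1} ... Z_m^{a_m} is stored as its exponent vector a, so
   the multiplicative group law is the addition of exponents. *)
Definition trop (m : nat) := {ffun 'I_m -> int}.

Definition trop_one m : trop m := [ffun=> 0].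
Definition trop_mul m (a b : trop m) : trop m := [ffun i => a i + b i].
Definition trop_exp m (a : trop m) (e : int) : trop m := [ffun i => a i * e].
Definition trop_inv m (a : trop m) : trop m := trop_exp a (-1).
Definition trop_oplus m (a b : trop m) : trop m :=
  [ffun i => Num.min (a i) (b i)].

(* Fractions of polynomials in n variables over K[Z_1, ..., Z_m].  As KP is
   the localization K[Z_1^{+-1}, ..., Z_m^{+-1}], this is also the field of
   rational functions in n variables with coefficients in KP. *)
Definition ratfun (K : idomainType) (m n : nat) : fieldType :=
  {fraction {mpoly {mpoly K[m]}[n]}}.

Definition scal (K : idomainType) m n (c : K) : ratfun K m n :=
  tofrac ((c%:MP_[m])%:MP_[n]).

Definition coefvar (K : idomainType) m n (i : 'I_m) : ratfun K m n :=
  tofrac (('X_i : {mpoly K[m]})%:MP_[n]).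

Definition tropF (K : idomainType) m n (a : trop m) : ratfun K m n :=
  \prod_(i < m) coefvar K n i ^ (a i).

(* The tropF a are linearly independent over K, so their K-span in F is the
   group ring KP. *)
Definition inKP (K : idomainType) m n (x : ratfun K m n) : Prop :=
  exists s : seq (K * trop m), x = \sum_(p <- s) scal m n p.1 * tropF K n p.2.

Definition invertibleKP (K : idomainType) m n (x : ratfun K m n) : Prop :=
  [/\ inKP x, x != 0 & inKP x^-1].

(* Polynomials in n variables over F all of whose coefficients are in KP. *)
Definition polyKP (K : idomainType) m n (p : {mpoly (ratfun K m n)[n]}) : Prop :=
  forall mon, inKP p@_mon.

Definition free_generating_set (K : idomainType) m n
    (A : {ffun 'I_n -> ratfun K m n}) : Prop :=
  (forall p, polyKP p -> p.@[A] = 0 -> p = 0) /\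
  (forall x, exists p q, [/\ polyKP p, polyKP q, q.@[A] != 0 &
                             x = p.@[A] / q.@[A]]).

Definition skew_symmetrizable n (B : 'M[int]_n) : Prop :=
  exists2 d : 'rV[int]_n, (forall i, 0 < d 0 i) &
    (diag_mx d *m B)^T = - (diag_mx d *m B).

Record seed (K : idomainType) (m n : nat) := Seed {
  exmat : 'M[int]_n;
  coefs : {ffun 'I_n -> trop m};
  cluster : {ffun 'I_n -> ratfun K m n}
}.

Definition is_seed (K : idomainType) m n (S : seed K m n) : Prop :=
  skew_symmetrizable (exmat S) /\ free_generating_set (cluster S).

Definition exchange_binomial (K : idomainType) m n (S : seed K m n) (k : 'I_n) :
    ratfun K m n :=
  let B := exmat S in let X := coefs S in let A := cluster S in
  let d := trop_inv (trop_oplus (trop_one m) (X k)) in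
  tropF K n (trop_mul (X k) d) * \prod_(j < n | 0 < B j k) A j ^ (B j k)
  + tropF K n d * \prod_(j < n | B j k < 0) A j ^ (- B j k).

Definition mutate (K : idomainType) m n (k : 'I_n) (S : seed K m n) :
    seed K m n :=
  let B := exmat S in let X := coefs S in let A := cluster S in
  Seed
    (\matrix_(i, j) if (i == k) || (j == k) then - B i j
                    else B i j + Num.sg (B i k) * Num.max (B i k * B k j) 0)
    [ffun i => if i == k then trop_inv (X k)
               else trop_mul
                      (trop_mul (X i) (trop_exp (X k) (Num.max (B k i) 0)))
                      (trop_exp (trop_oplus (trop_one m) (X k)) (- B k i))]
    [ffun i => if i == k then (A k)^-1 * exchange_binomial S k else A i].

(* Vertices are the words in the labels without two equal consecutive letters;
   removing or appending a last letter k is crossing the edge labeled k. *)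
Definition tree (n : nat) :=
  {w : seq 'I_n | sorted (fun i j => i != j) w}.

Definition tree_edge n (k : 'I_n) (t t' : tree n) : bool :=
  (val t' == rcons (val t) k) || (val t == rcons (val t') k).

Definition seed_pattern (K : idomainType) m n (S : tree n -> seed K m n) : Prop :=
  (forall t, is_seed (S t)) /\
  (forall k t t', tree_edge k t t' -> S t' = mutate k (S t)).

Definition laurent (K : idomainType) m n (A : {ffun 'I_n -> ratfun K m n})
    (x : ratfun K m n) : Prop :=
  exists2 s : seq (ratfun K m n * {ffun 'I_n -> int}),
    (forall p, p \in s -> inKP p.1) &
    x = \sum_(p <- s) p.1 * \prod_(i < n) A i ^ (p.2 i).

Definition upper (K : idomainType) m n (S : tree n -> seed K m n)
    (x : ratfun K m n) : Prop :=
  forall t, laurent (cluster (S t)) x.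

Definition extended_exmat (K : idomainType) m n (S : seed K m n) :
    'M[int]_(n + m, n) :=
  col_mx (exmat S) (\matrix_(i < m, k < n) coefs S k i).

Definition full_rank (K : idomainType) m n (S : seed K m n) : Prop :=
  \rank (map_mx intr (extended_exmat S) : 'M[rat]_(n + m, n)) = n.

Definition is_max_nat (E : nat -> Prop) (s : nat) : Prop :=
  E s /\ forall r, E r -> (r <= s)%N.

(* None stands for infinity. *)
Definition vpairing (K : idomainType) m n (S : tree n -> seed K m n)
    (t : tree n) (k : 'I_n) (M : ratfun K m n) : option nat :=
  match pselect (exists s, is_max_nat
                   (fun r => upper S (M / cluster (S t) k ^+ r)) s) with
  | left h => Some (projT1 (cid h))
  | right _ => None
  end.

Definition cluster_monomial (K : idomainType) m n (S : seed K m n)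
    (N : ratfun K m n) : Prop :=
  exists d : {ffun 'I_n -> nat}, N = \prod_(i < n) cluster S i ^+ d i.

Definition local_factorization (K : idomainType) m n
    (S : tree n -> seed K m n) (t : tree n) (M : ratfun K m n)
    (NL : ratfun K m n * ratfun K m n) : Prop :=
  [/\ M = NL.1 * NL.2,
      cluster_monomial (S t) NL.1,
      upper S NL.2 &
      forall k, vpairing S t k NL.2 = Some 0%N].

(* Main.v *)
(* The Laurent ring L(t) is graded by every linear functional on exponent
   vectors, and all divisibility arguments take place inside such gradings, so
   that no unique factorization is needed.

   Regularity: if f is homogeneous of degree 0 and h only has terms of positive
   degree, then 1 + h is regular modulo f.

   Starfish: for k != j put f = A_j and d = P_k A'_j.  Both lie in
   V = L(mu_j mu_k t); powers of f clear the denominators of L(mu_k t) in V and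
   powers of d those of L(mu_j t).  When b_jk != 0, P_k is a unit of V modulo f,
   and A'_j is regular modulo f because of its term of degree 1 in the new
   variable A''_j.  When b_jk = 0, A'_j is a unit of V, and P_k and P_j are
   binomials with linearly independent exponent vectors by the rank hypothesis,
   so a functional that kills the one but not the other shows that P_k is
   regular modulo f.  Hence L(mu_k t) and L(mu_j t) meet inside V, and walking
   along the tree U = L(t_0) /\ L(mu_1 t_0) /\ ... /\ L(mu_n t_0).

   Each A_i with i != k is invertible in L(mu_k t_0), so the divisibility of M
   by a cluster monomial can be tested one exponent at a time: the exponent of
   A_k in N is the largest r such that M / A_k^r lies in L(mu_k t_0). *)
Require Import Defs.
From HB Require Import structures.
From mathcomp Require Import all_boot all_order all_algebra.
From mathcomp Require Import boolp.
From mathcomp Require Import mpoly.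
From mathcomp Require Import ring zify.

Set Implicit Arguments.
Unset Strict Implicit.
Unset Printing Implicit Defensive.

Import Order.TTheory GRing.Theory Num.Theory.
Local Open Scope ring_scope.

(** * Graded Laurent rings *)

Section Laurent.
Variables (K : comNzRingType) (F : fieldType) (c : {rmorphism K -> F}).
Variable I : finType.

Record frame := Frame { gen :> I -> F; gen_neq0 : forall i, gen i != 0 }.

Implicit Types (g : frame) (e l : {ffun I -> int}).
Implicit Types (Q : pred {ffun I -> int}).

Definition mon g e : F := \prod_i g i ^ e i.

Definition deg l e : int := \sum_i l i * e i.

Definition mspan g Q : {pred F} := fun x =>
  `[< exists2 s : seq (K * {ffun I -> int}), all (fun p => Q p.2) s &
      x = \sum_(p <- s) c p.1 * mon g p.2 >].

Definition laur g := mspan g predT.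
Definition laur_nneg g l := mspan g (fun e => 0 <= deg l e).

(** A list may repeat an exponent vector, so linear independence over [K] asks the collected
    coefficient of each vector to vanish. *)
Definition independent g := forall s : seq (K * {ffun I -> int}),
  \sum_(p <- s) c p.1 * mon g p.2 = 0 ->
  forall e, \sum_(p <- s | p.2 == e) p.1 = 0.

Lemma mon0 g : mon g 0 = 1.
Proof. by apply: big1 => i _; rewrite ffunE expr0z. Qed.

Lemma monD g e e' : mon g (e + e') = mon g e * mon g e'.
Proof.
by rewrite -big_split; apply: eq_bigr => i _; rewrite ffunE expfzDr ?gen_neq0.
Qed.

Lemma mon_neq0 g e : mon g e != 0.
Proof. by apply/prodf_neq0 => i _; rewrite expfz_neq0 ?gen_neq0. Qed.

Lemma monN g e : mon g (- e) = (mon g e)^-1.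
Proof.
apply: (mulIf (mon_neq0 g e)).
by rewrite -monD addNr mon0 mulVf // mon_neq0.
Qed.

Lemma monMn g e k : mon g (e *+ k) = mon g e ^+ k.
Proof.
by elim: k => [|k IHk]; rewrite ?mulr0n ?mon0 // mulrS monD IHk exprS.
Qed.

Lemma eq_mon g g' e : (forall i, e i != 0 -> g i = g' i) -> mon g e = mon g' e.
Proof.
move=> gg'; apply: eq_bigr => i _.
by have [-> //|/gg'-> //] := eqVneq (e i) 0; rewrite !expr0z.
Qed.

Lemma deg0 l : deg l 0 = 0.
Proof. by apply: big1 => i _; rewrite ffunE mulr0. Qed.

Lemma degD l e e' : deg l (e + e') = deg l e + deg l e'.
Proof. by rewrite -big_split; apply: eq_bigr => i _; rewrite ffunE mulrDr. Qed.

Lemma degN l e : deg l (- e) = - deg l e.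
Proof. by apply/eqP; rewrite -addr_eq0 -degD addNr deg0. Qed.

Lemma degC l e : deg l e = deg e l.
Proof. by apply: eq_bigr => i _; rewrite mulrC. Qed.

Lemma deg_self_gt0 e : e != 0 -> 0 < deg e e.
Proof.
move=> e0; have sq i : true -> 0 <= e i * e i by rewrite -expr2 sqr_ge0.
rewrite lt_def sumr_ge0 // andbT psumr_eq0 //; apply: contra e0 => /allP h.
apply/eqP/ffunP => i; rewrite ffunE; apply/eqP.
by have := h i (mem_index_enum i); rewrite mulf_eq0 orbb.
Qed.

Lemma mspan_ind g Q (P : F -> Prop) :
  P 0 -> (forall x y, P x -> P y -> P (x + y)) ->
  (forall a e, Q e -> P (c a * mon g e)) ->
  forall x, x \in mspan g Q -> P x.
Proof.
move=> P0 PD Pt x /asboolP[s sQ ->]; elim: s sQ => [|[a e] s IHs] /=.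
  by rewrite big_nil.
by move=> /andP[Qe /IHs Ps]; rewrite big_cons; apply: PD => //; apply: Pt.
Qed.

Lemma mspan0 g Q : 0 \in mspan g Q.
Proof. by apply/asboolP; exists [::]; rewrite ?big_nil. Qed.

Lemma mspanD g Q x y : x \in mspan g Q -> y \in mspan g Q -> x + y \in mspan g Q.
Proof.
move=> /asboolP[s sQ ->] /asboolP[s' s'Q ->]; apply/asboolP.
by exists (s ++ s'); rewrite ?big_cat // all_cat sQ.
Qed.

Lemma mspan_term g Q a e : Q e -> c a * mon g e \in mspan g Q.
Proof. by move=> Qe; apply/asboolP; exists [:: (a, e)]; rewrite ?big_seq1 //= Qe. Qed.

Lemma mspan_mon g Q e : Q e -> mon g e \in mspan g Q.
Proof. by move=> Qe; rewrite -[mon g e]mul1r -(rmorph1 c) mspan_term. Qed.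

Lemma mspanN g Q x : x \in mspan g Q -> - x \in mspan g Q.
Proof.
move: x; apply: mspan_ind => [|x y Sx Sy|a e Qe]; first by rewrite oppr0 mspan0.
  by rewrite opprD mspanD.
by rewrite -mulNr -rmorphN mspan_term.
Qed.

Lemma mspan_sum g Q (J : Type) (r : seq J) (P : pred J) (f : J -> F) :
  (forall j, P j -> f j \in mspan g Q) -> \sum_(j <- r | P j) f j \in mspan g Q.
Proof. by move=> h; elim/big_ind: _ => // [|x y]; [apply: mspan0|apply: mspanD]. Qed.

Lemma mspanM g Q1 Q2 Q x y : 
  (forall e e', Q1 e -> Q2 e' -> Q (e + e')) ->
  x \in mspan g Q1 -> y \in mspan g Q2 -> x * y \in mspan g Q.
Proof.
move=> QM Sx Sy; move: x Sx; apply: mspan_ind => [|x x' Sx Sx'|a e Qe].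
- by rewrite mul0r mspan0.
- by rewrite mulrDl mspanD.
move: y Sy; apply: mspan_ind => [|y y' Sy Sy'|a' e' Qe'].
- by rewrite mulr0 mspan0.
- by rewrite mulrDr mspanD.
by rewrite mulrACA -rmorphM -monD mspan_term // QM.
Qed.

Lemma mspanS g Q Q' : (forall e, Q e -> Q' e) -> {subset mspan g Q <= mspan g Q'}.
Proof.
move=> QQ'; apply: mspan_ind => [|x y Sx Sy|a e /QQ' Qe].
- exact: mspan0.
- exact: mspanD.
exact: mspan_term.
Qed.

Lemma mspan_laur g Q : {subset mspan g Q <= laur g}.
Proof. exact: mspanS. Qed.

Lemma laur_mon g e : mon g e \in laur g. Proof. exact: mspan_mon. Qed.

Lemma laur_scal g a : c a \in laur g.
Proof. by rewrite -[c a]mulr1 -(mon0 g) mspan_term. Qed.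

Lemma mspan_subring g Q : Q 0 ->
  (forall e e', Q e -> Q e' -> Q (e + e')) -> subring_closed (mspan g Q).
Proof.
move=> Q0 QD; split=> [|x y Sx Sy|x y].
- by rewrite -(mon0 g) mspan_mon.
- by rewrite mspanD ?mspanN.
exact: mspanM.
Qed.

Lemma laur_subring g : subring_closed (laur g).
Proof. exact: mspan_subring. Qed.

Lemma laur_nneg_subring g l : subring_closed (laur_nneg g l).
Proof.
apply: mspan_subring => [|e e']; first by rewrite deg0.
by rewrite degD; apply: addr_ge0.
Qed.

HB.instance Definition _ g := GRing.isSubringClosed.Build F (laur g) (laur_subring g).
HB.instance Definition _ g l :=
  GRing.isSubringClosed.Build F (laur_nneg g l) (laur_nneg_subring g l).

(** Sort the relation by exponent vector: each class already sums to zero, hence so does every union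
    of classes. *)
Lemma independent_sub g s Q : independent g ->
  \sum_(p <- s) c p.1 * mon g p.2 = 0 ->
  \sum_(p <- s | Q p.2) c p.1 * mon g p.2 = 0.
Proof.
move=> ind /ind s0.
pose es := undup [seq p.2 | p <- s].
have -> : \sum_(p <- s | Q p.2) c p.1 * mon g p.2 =
    \sum_(p <- s | Q p.2) \sum_(e <- es | e == p.2) c p.1 * mon g p.2.
  rewrite [LHS]big_seq_cond [RHS]big_seq_cond; apply: eq_bigr => p /andP[ps _].
  rewrite -big_filter filter_pred1_uniq ?undup_uniq ?big_seq1 // mem_undup.
  exact: map_f.
rewrite (exchange_big_dep predT) //=; apply: big1 => e _.
rewrite (eq_bigl (fun p => (p.2 == e) && Q e)); last first.
  by move=> p; rewrite eq_sym andbC; case: eqP => // ->.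
case: (Q e); last by apply: big1 => p; rewrite andbF.
rewrite (eq_bigl (fun p => p.2 == e)); last by move=> p; rewrite andbT.
rewrite (eq_bigr (fun p => c p.1 * mon g e)); last by move=> p /eqP->.
by rewrite -mulr_suml -rmorph_sum s0 rmorph0 mul0r.
Qed.

(* p splits p.[1] into homogeneous components: 'X^i carries degree i - N. *)
Definition lifts g l (N : nat) (p : {poly F}) :=
  forall i : nat, p`_i \in mspan g (fun e => deg l e + N%:Z == i%:Z).

Lemma lifts0 g l N : lifts g l N 0.
Proof. by move=> i; rewrite coef0 mspan0. Qed.

Lemma liftsD g l N p q : lifts g l N p -> lifts g l N q -> lifts g l N (p + q).
Proof. by move=> pl ql i; rewrite coefD mspanD. Qed.

Lemma liftsN g l N p : lifts g l N p -> lifts g l N (- p).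
Proof. by move=> pl i; rewrite coefN mspanN. Qed.

Lemma lifts_shift g l N k p : lifts g l N p -> lifts g l (k + N) ('X^k * p).
Proof.
move=> pl i; rewrite coefXnM; case: ltnP => [_|ki]; first exact: mspan0.
apply: mspanS (pl (i - k)%N) => e /eqP h; lia.
Qed.

Lemma liftsM g l N M p q :
  lifts g l N p -> lifts g l M q -> lifts g l (N + M) (p * q).
Proof.
move=> pl ql i; rewrite coefM; apply: mspan_sum => j _.
apply: mspanM (pl j) (ql (i - j)%N) => e e' /eqP h /eqP h'.
rewrite degD; have := ltn_ord j; lia.
Qed.

Lemma lifts_laur g l N p i : lifts g l N p -> p`_i \in laur g.
Proof. by move=> /(_ i)/mspan_laur. Qed.

Lemma lifts_exists g l x : x \in laur g ->
  exists N p, lifts g l N p /\ p.[1] = x.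
Proof.
move: x; apply: mspan_ind => [|x y [N [p [pl <-]]] [M [q [ql <-]]]|a e _].
- by exists 0%N, 0; split; [apply: lifts0|rewrite horner0].
- exists (M + N)%N, ('X^M * p + 'X^N * q); split.
    by apply: liftsD; [|rewrite addnC]; apply: lifts_shift.
  by rewrite hornerD !hornerM !hornerXn !expr1n !mul1r.
(* The offset [|deg l e|] makes the shifted degree non-negative, so that it can serve as an exponent
   of ['X]. *)
exists `|deg l e|%N, ((c a * mon g e) *: 'X^(absz (deg l e + `|deg l e|%N))).
split; last by rewrite hornerZ hornerXn expr1n mulr1.
move=> i; rewrite coefZ coefXn; case: eqP => [->|_]; last by rewrite mulr0 mspan0.
rewrite mulr1; apply: mspan_term; lia.
Qed.

(** The coefficients of [p] involve disjoint sets of exponent vectors, so the relation [p.[1] = 0]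
    restricts to one in each degree. *)
Lemma lifts_eq0 g l N p : independent g -> lifts g l N p -> p.[1] = 0 -> p = 0.
Proof.
move=> ind pl p1.
have /choice[s hs] : forall i, exists s : seq (K * {ffun I -> int}),
    all (fun q => deg l q.2 + N%:Z == i%:Z) s /\
    p`_i = \sum_(q <- s) c q.1 * mon g q.2.
  by move=> i; have /asboolP[s sl ps] := pl i; exists s.
pose S := flatten [seq s i | i <- iota 0 (size p)].
have S0 : \sum_(q <- S) c q.1 * mon g q.2 = 0.
  rewrite big_flatten big_map -[RHS]p1 horner_coef.
  rewrite -(big_mkord xpredT (fun i => p`_i * 1 ^+ i)).
  rewrite /index_iota subn0; apply: eq_bigr => i _.
  by rewrite expr1n mulr1; case: (hs i).
apply/polyP => i; rewrite coef0; have [ip|/(nth_default 0)//] := ltnP i (size p).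
have := independent_sub (fun e => deg l e + N%:Z == i%:Z) ind S0.
rewrite big_flatten big_map (bigD1_seq i) ?iota_uniq ?mem_iota //=.
rewrite [X in _ + X]big1 ?addr0 => [|j ji].
  have [sl ->] := hs i => h; rewrite -[RHS]h [LHS]big_seq [RHS]big_seq_cond.
  by apply: eq_bigl => q; case: (boolP (q \in _)) => // /(allP sl)->.
rewrite big_seq_cond; apply: big1 => q /andP[qs /eqP h].
have /allP/(_ q qs)/eqP := (hs j).1; rewrite h => -[/esym/eqP].
by rewrite (negPf ji).
Qed.

Lemma lifts_inj g l N p q : independent g ->
  lifts g l N p -> lifts g l N q -> p.[1] = q.[1] -> p = q.
Proof.
move=> ind pl ql pq; apply/eqP; rewrite -subr_eq0; apply/eqP.
apply: (lifts_eq0 ind (liftsD pl (liftsN ql))).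
by rewrite hornerD hornerN pq subrr.
Qed.

Lemma lifts_gt0 g l h : h \in mspan g (fun e => 0 < deg l e) ->
  exists p, lifts g l 0 ('X * p) /\ p.[1] = h.
Proof.
move: h; apply: mspan_ind => [|x y [p [pl <-]] [q [ql <-]]|a e e0].
- by exists 0; rewrite mulr0 horner0; split=> //; apply: lifts0.
- by exists (p + q); rewrite mulrDr hornerD; split=> //; apply: liftsD.
exists ((c a * mon g e) *: 'X^(absz (deg l e - 1))).
split; last by rewrite hornerZ hornerXn expr1n mulr1.
rewrite -scalerAr -exprS => i; rewrite coefZ coefXn.
case: eqP => [->|_]; last by rewrite mulr0 mspan0.
rewrite mulr1; apply: mspan_term; lia.
Qed.

(** Work upwards from the constant term: the product has the same one as [p], and subtracting its
    contribution leaves the same situation with [p] shifted down by one degree. *)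
Lemma poly_regular (V : subringClosed F) (f : F) (a p : {poly F}) :
  f \in V -> (forall i, a`_i \in V) ->
  (forall i, ((1 + 'X * a) * p)`_i / f \in V) -> forall i, p`_i / f \in V.
Proof.
move=> fV aV; elim/poly_ind: p => [|p x IHp] apV.
  by move=> i; rewrite coef0 mul0r rpred0.
have xV : x / f \in V.
  have := apV 0%N; rewrite mulrDl mul1r -mulrA !coefD coefXM addr0.
  by rewrite coefMX coefC add0r.
have {}IHp : forall i, p`_i / f \in V.
  apply: IHp => i; have := apV i.+1.
  rewrite mulrDr mulrA !coefD coefMX coefMC mulrDl => h.
  rewrite -[X in X \in _](addrK ((1 + 'X * a)`_i.+1 * x / f)); apply: rpredB => //.
  rewrite -mulrA rpredM // coefD coef1 coefXM add0r; exact: aV.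
move=> i; rewrite coefD coefMX coefC; case: i => [|i] /=; first by rewrite add0r.
by rewrite addr0.
Qed.

(* Comparing lowest coefficients of lifts, 1 + h lifts to a polynomial with
   constant coefficient 1 while f lifts to a constant. *)
Lemma laur_regular g l f h y : independent g ->
  f != 0 -> f \in mspan g (fun e => deg l e == 0) ->
  h \in mspan g (fun e => 0 < deg l e) -> y \in laur g ->
  (1 + h) * y / f \in laur g -> y / f \in laur g.
Proof.
move=> ind f0 fl /lifts_gt0[a [al ah]] /(lifts_exists l)[N [p [pl <-]]].
move=> /(lifts_exists l)[M [q [ql qe]]].
have one_l : lifts g l 0 1.
  move=> i; rewrite coef1; case: eqP => [->|_]; last exact: mspan0.
  by rewrite -(mon0 g) mspan_mon // deg0.
have f_l : lifts g l 0 f%:P.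
  move=> i; rewrite coefC; case: eqP => [->|_]; last exact: mspan0.
  by apply: mspanS fl => e /eqP /= ->.
have eq : (1 + 'X * a) * ('X^M * p) = f%:P * ('X^N * q).
  apply: (@lifts_inj g l (0 + (M + N))) => //.
  - by apply/liftsM/lifts_shift => //; apply: liftsD.
  - by rewrite [(M + N)%N]addnC; apply/liftsM/lifts_shift.
  rewrite !(hornerM, hornerD, hornerC, hornerX, hornerXn, expr1n, mul1r) ah qe; field.
  exact: f0.
have pV i : ('X^M * p)`_i / f \in laur g.
  move: i; apply: (@poly_regular _ _ a) => [|i|i].
  - exact: mspan_laur fl.
  - by have := lifts_laur i.+1 al; rewrite coefXM.
  rewrite eq coefCM mulrC mulKf //; exact: lifts_laur i (lifts_shift N ql).
rewrite horner_coef mulr_suml rpred_sum // => i _.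
by rewrite expr1n mulr1; have := pV (M + i)%N; rewrite coefXnM ltnNge leq_addr addKn.
Qed.

(** The lift [1 + 'X * a] of [1 + h] has constant coefficient 1, so it is coprime to ['X] and its
    [r]-th power divides the lift [p] of [x]. It is not constant because [h] is non-zero, so the
    size of [p] bounds [r]. *)
Lemma laur_bounded g l h x : independent g ->
  h != 0 -> h \in mspan g (fun e => 0 < deg l e) -> x \in laur g -> x != 0 ->
  exists B : nat, forall r y, y \in laur g -> x = (1 + h) ^+ r * y -> (r <= B)%N.
Proof.
move=> ind h0 /lifts_gt0[a [al ah]] /(lifts_exists l)[N [p [pl pe]]] x0.
have p0 : p != 0 by apply: contra_neq x0 => p0; rewrite -pe p0 horner0.
have one_l : lifts g l 0 1.
  move=> i; rewrite coef1; case: eqP => [->|_]; last exact: mspan0.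
  by rewrite -(mon0 g) mspan_mon // deg0.
have a0 : a != 0 by apply: contra_neq h0 => a0; rewrite -ah a0 horner0.
exists (size p) => r y /(lifts_exists l)[M [q [ql qe]]] xe.
pose b := 1 + 'X * a.
have b1 : b.[1] = 1 + h.
  by rewrite hornerD hornerM hornerC hornerX mul1r ah.
have bl k : lifts g l 0 (b ^+ k).
  elim: k => [|k IHk]; rewrite ?expr0 // exprS -[0%N]addn0.
  by apply: liftsM => //; apply: liftsD.
have eq : b ^+ r * ('X^N * q) = 'X^M * p.
  apply: (@lifts_inj g l (0 + (N + M))) => //.
  - exact/liftsM/lifts_shift.
  - by rewrite add0n addnC; apply: lifts_shift.
  by rewrite !(hornerM, horner_exp) b1 hornerX !expr1n pe xe qe !mul1r.
have bX : coprimep (b ^+ r) 'X^M.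
  rewrite coprimep_expl // coprimep_expr // coprimepX /root.
  by rewrite hornerD hornerM hornerX hornerC mul0r addr0 oner_eq0.
have sb : size b = (size a).+1.
  rewrite /b addrC size_polyDl mulrC size_mulX // size_poly1.
  by rewrite ltnS lt0n size_poly_eq0.
have : b ^+ r %| p.
  by rewrite -(Gauss_dvdpr p bX) -eq dvdp_mulr.
move=> /dvdp_leq -/(_ p0); apply: leq_trans.
by rewrite (leq_trans _ (leq_pred _)) // size_exp sb leq_pmull // lt0n size_poly_eq0.
Qed.

(** The elements that some power of [d] brings into [V] are closed under sums and products, and
    include the scalars, the generators and their inverses. *)
Lemma laur_clear (V : subringClosed F) g d x :
  (forall a, c a \in V) -> d \in V ->
  (forall i, d * g i \in V) -> (forall i, d / g i \in V) ->
  x \in laur g -> exists N, d ^+ N * x \in V.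
Proof.
move=> cV dV gV gV'.
have PM y z : (exists N, d ^+ N * y \in V) -> (exists N, d ^+ N * z \in V) ->
    exists N, d ^+ N * (y * z) \in V.
  move=> [N yV] [M zV]; exists (N + M)%N.
  by rewrite exprD mulrACA rpredM.
have P1 : exists N, d ^+ N * 1 \in V by exists 0%N; rewrite mulr1 rpred1.
have PX y k : (exists N, d ^+ N * y \in V) -> exists N, d ^+ N * y ^+ k \in V.
  by move=> yV; elim: k => // k IHk; rewrite exprS; apply: PM.
move: x; apply: mspan_ind => [|y z [N yV] [M zV]|a e _].
- by exists 0%N; rewrite mulr0 rpred0.
- exists (N + M)%N; rewrite mulrDr exprD rpredD //; last by rewrite -mulrA rpredM ?rpredX.
  by rewrite [_ ^+ N * _]mulrC -mulrA rpredM ?rpredX.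
apply: (PM); first by exists 0%N; rewrite mul1r.
rewrite /mon; elim/big_ind: _ => [//|y z|i _]; first exact: PM.
case: (e i) => k.
  by apply: PX; exists 1%N.
by rewrite NegzE -exprnN -exprVn; apply: PX; exists 1%N.
Qed.

(** Lower [N] one step at a time: for [N > 0], [d ^+ M * f ^+ N * x / f] lies in [V] because
    [d ^+ M * x] does, and regularity of [d] modulo [f] removes the power of [d]. *)
Lemma regular_saturated (V : subringClosed F) f d x N M :
  f != 0 -> f \in V -> d \in V ->
  (forall y, y \in V -> d * y / f \in V -> y / f \in V) ->
  f ^+ N * x \in V -> d ^+ M * x \in V -> x \in V.
Proof.
move=> f0 fV dV reg fx dx.
have regM k y : y \in V -> d ^+ k * y / f \in V -> y / f \in V.
  elim: k y => [|k IHk] y yV; first by rewrite mul1r.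
  rewrite exprS -(mulrA d) => h; apply: (IHk y) => //.
  by apply: (reg (d ^+ k * y)) => //; rewrite rpredM ?rpredX.
have divf k : f ^+ k.+1 * x / f = f ^+ k * x by rewrite exprS; field.
elim: N fx => [|N IHN] fx; first by rewrite mul1r in fx.
apply: IHN; rewrite -divf; apply: (regM M) => //.
by rewrite -mulrA divf mulrCA rpredM ?rpredX.
Qed.

End Laurent.

(** * Exchanging two variables *)

Section Exchange.
Variables (K : comNzRingType) (F : fieldType) (c : {rmorphism K -> F}).
Variable I : finType.
Implicit Types (g : frame F I) (e u w l : {ffun I -> int}).

Definition basis_vec (i : I) : {ffun I -> int} := [ffun i' => (i' == i)%:Z].

Definition pos_part e : {ffun I -> int} := [ffun i => Num.max (e i) 0].

Definition exch_binom g e : F := mon g (pos_part e) + mon g (pos_part (- e)).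

(** With [u] the column [k] of an extended exchange matrix and [w] another column, this is that
    other column after mutation at [k]; matrix rows and coefficient rows obey the same rule. *)
Definition mut_vec k u w : {ffun I -> int} :=
  [ffun i => if i == k then - w i
             else w i + Num.sg (u i) * Num.max (u i * w k) 0].

Definition is_mutation g k u g' :=
  forall i, g' i = if i == k then (g k)^-1 * exch_binom g u else g i.

Lemma deg_basis_vec i e : deg (basis_vec i) e = e i.
Proof.
rewrite /deg (bigD1 i) //= ffunE eqxx mul1r big1 ?addr0 // => i' /negPf ii'.
by rewrite ffunE ii' mul0r.
Qed.

Lemma mon_basis_vec g i : mon g (basis_vec i) = g i.
Proof.
rewrite /mon (bigD1 i) //= ffunE eqxx expr1z big1 ?mulr1 // => i' /negPf ii'.
by rewrite ffunE ii' expr0z.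
Qed.

Lemma exch_binomN g e : exch_binom g (- e) = exch_binom g e.
Proof. by rewrite /exch_binom opprK addrC. Qed.

Lemma exch_binomE g e : exch_binom g e = mon g (pos_part (- e)) * (1 + mon g e).
Proof.
rewrite mulrDr mulr1 -monD [RHS]addrC; congr (mon _ _ + _).
by apply/ffunP => i; rewrite !ffunE; move: (e i) => x; lia.
Qed.

Lemma mut_vecN k u w : mut_vec k (- u) (- w) = - mut_vec k u w.
Proof.
apply/ffunP => i; rewrite !ffunE; case: eqP => // _.
by rewrite mulrNN sgrN mulNr opprD.
Qed.

Lemma is_mutationN g k u g' : is_mutation g k u g' -> is_mutation g k (- u) g'.
Proof. by move=> h i; rewrite exch_binomN. Qed.

(** Because [u k = 0], the binomial has the same value in both frames, and the exchange relation can
    be solved for the old variable. *)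
Lemma is_mutation_inv g k u g' : u k = 0 -> is_mutation g k u g' ->
  g k = mon g' (pos_part (- u) - basis_vec k) * (1 + mon g' u).
Proof.
move=> uk mk; have mE e : e k = 0 -> mon g e = mon g' e.
  move=> ek; apply: eq_mon => i ei; rewrite mk ifN //.
  by apply: contra_neq ei => ->.
have := mk k; rewrite eqxx exch_binomE !mE //; last by rewrite !ffunE uk; lia.
move=> g'k; rewrite monD monN mon_basis_vec mulrAC.
have -> : mon g' (pos_part (- u)) * (1 + mon g' u) = g k * g' k.
  by rewrite g'k mulrA divff ?gen_neq0 // mul1r.
by rewrite mulfK ?gen_neq0.
Qed.

(* In V = laur c g2, g j = U (1 + W), the exchange binomial of k is
   g k * g2 k = M (1 + t), and the exchanged variable is gj j = v (1 + U W S),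
   where U, W, M and v are monomials and S is a polynomial in g j and monomials
   of V free of g2 j; U W S has degree > 0 for minus the exponent of g2 j. *)
Lemma laur_exchange_pos g g1 gj g2 k j u w x :
  k != j -> u k = 0 -> w j = 0 -> Num.sg (u j) = - Num.sg (w k) -> 0 <= w k ->
  is_mutation g k u g1 -> is_mutation g j w gj ->
  is_mutation g1 j (mut_vec k u w) g2 -> independent c g2 ->
  (w k = 0 -> exists l, 0 < deg l (- u) /\ deg l w = 0) ->
  x \in laur c g1 -> x \in laur c gj -> x \in laur c g2.
Proof.
move=> kj uk wj sgn wk_ge0 m1 mj m2 ind cop x1 xj.
have jk : j != k by rewrite eq_sym.
(* By the sign condition [u j] and [w k] have opposite signs, so [p] and [q] vanish together. *)
have [q wk] : exists q : nat, w k = q%:Z by exists `|w k|%N; rewrite gez0_abs.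
have [p uj] : exists p : nat, u j = - p%:Z by exists `|u j|%N; lia.
have pq : (p == 0%N) = (q == 0%N) by lia.
set w' := mut_vec k u w in m2.
have w'E i : i != k -> w' i = w i + pos_part u i *+ q.
  by move=> /negPf ik; rewrite !ffunE ik wk -mulr_natr; nia.
have w'k : w' k = - q%:Z by rewrite ffunE eqxx wk.
have w'j : w' j = 0 by rewrite w'E // wj ffunE uj -mulr_natr; nia.
clearbody w'.
have Vmon e : mon g2 e \in laur c g2 by apply: laur_mon.
have VmonV e : (mon g2 e)^-1 \in laur c g2 by rewrite -monN.
have g2V i : g2 i \in laur c g2 by rewrite -mon_basis_vec.
have g2VV i : (g2 i)^-1 \in laur c g2 by rewrite -mon_basis_vec.
have g2E i : i != k -> i != j -> g2 i = g i.
  by move=> /negPf ik /negPf ij; rewrite m2 ij m1 ik.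
have mon2 e : e k = 0 -> e j = 0 -> mon g e = mon g2 e.
  move=> ek ej; apply: eq_mon => i ei; rewrite g2E //.
    by apply: contra_neq ei => ->.
  by apply: contra_neq ei => ->.
pose W := mon g2 w'; pose M := mon g2 (pos_part u); pose t := mon g (- u).
pose U := mon g2 (pos_part (- w') - basis_vec j).
pose v := mon g2 (pos_part (- w) + basis_vec j - pos_part (- w')).
have U0 : U != 0 by apply: mon_neq0.
have gjE : g j = U * (1 + W).
  by rewrite -(is_mutation_inv w'j m2) m1 (negPf jk).
have W0 : 1 + W != 0.
  by apply: contraTneq (gen_neq0 g j) => h; rewrite gjE h mulr0 eqxx.
have ME : mon g (pos_part u) = M.
  by apply: mon2; rewrite ffunE ?uk ?uj; lia.
have DE : g k * g2 k = M * (1 + t).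
  rewrite m2 (negPf kj) m1 eqxx mulrA divff ?gen_neq0 // mul1r.
  by rewrite -exch_binomN exch_binomE opprK ME.
pose M' := mon g2 (- u - basis_vec j *+ p).
have tE : t = g j ^+ p * M'.
  rewrite -mon_basis_vec -monMn /M' -mon2 -?monD; first by rewrite addrC subrK.
    by rewrite !ffunE uk ffunMnE ffunE (negPf kj) mul0rn.
  by rewrite !ffunE uj ffunMnE ffunE eqxx opprK; lia.
(* Substituting [M * (1 + t) / g2 k] for [g k] produces [(1 + t) ^+ q]; the remaining factors
   assemble to [W] by the mutation rule behind [w']. *)
have YE : mon g w = W * (1 + t) ^+ q.
  have -> : w = basis_vec k *+ q + (w - basis_vec k *+ q) by rewrite addrC subrK.
  rewrite monD monMn mon_basis_vec [X in _ * X]mon2; last 2 first.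
  - by rewrite !ffunE wk ffunMnE ffunE eqxx; lia.
  - by rewrite !ffunE wj ffunMnE ffunE (negPf jk) mul0rn.
  have -> : g k = M * (1 + t) / g2 k by rewrite -DE mulfK ?gen_neq0.
  have -> : W = mon g2 (w - basis_vec k *+ q) * M ^+ q / g2 k ^+ q.
    rewrite -[g2 k]mon_basis_vec -!monMn -monN -!monD; congr mon.
    apply/ffunP => i; have [->|ik] := eqVneq i k.
      by rewrite !ffunE !ffunMnE !ffunE eqxx w'k wk uk; lia.
    by rewrite w'E // !ffunE !ffunMnE !ffunE (negPf ik) !mul0rn !subr0.
  rewrite !expr_div_n exprMn; field.
  by rewrite expf_neq0 ?gen_neq0.
pose S := ((1 + t) ^+ q - 1) / g j.
(* Here [(1 + t) ^+ q] is [1 + g j * S] and [g j] is [U * (1 + W)], so the factor [1 + W] cancels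
   from the exchange relation. *)
have AE : gj j = v * (1 + U * (W * S)).
  rewrite mj eqxx exch_binomE YE /v monD monN monD mon_basis_vec mon2; last 2 first.
  - by rewrite ffunE [(- w) k]ffunE wk; lia.
  - by rewrite ffunE [(- w) j]ffunE wj; lia.
  have -> : mon g2 (pos_part (- w')) = U * g2 j.
    by rewrite -[g2 j]mon_basis_vec -monD subrK.
  rewrite /S gjE; field.
  by rewrite U0 gen_neq0 W0.
pose l := - basis_vec j.
have degl e : deg l e = - e j by rewrite degC degN degC deg_basis_vec.
have W_deg : w' j == 0 by rewrite w'j.
have nn e : e j <= 0 -> mon g2 e \in laur_nneg c g2 l.
  by move=> ej; apply: mspan_mon; rewrite degl; lia.
have Uj : (pos_part (- w') - basis_vec j) j = -1.
  by rewrite !ffunE w'j eqxx.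
have gj_nn : g j \in laur_nneg c g2 l.
  by rewrite gjE rpredM ?rpredD ?rpred1 ?nn ?Uj ?w'j.
have M'_nn : M' \in laur_nneg c g2 l.
  by rewrite nn // !ffunE uj ffunMnE ffunE eqxx; lia.
have t_nn : t \in laur_nneg c g2 l by rewrite tE rpredM ?rpredX.
have tj : (0 < p)%N -> t / g j = g j ^+ p.-1 * M'.
  move=> p0; rewrite tE -{1}(prednK p0) exprS; field; exact: gen_neq0.
(* Division by [g j] leaves no denominator: if [q > 0] then [p > 0], so [t] is a multiple of [g j],
   and [t] divides [(1 + t) ^+ q - 1]. *)
have S_nn : S \in laur_nneg c g2 l.
  rewrite /S; have [->|q0] := posnP q; first by rewrite expr0 subrr mul0r rpred0.
  rewrite subrX1 (addrC 1 t) addrK mulrAC tj; last by rewrite lt0n pq -lt0n.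
  by rewrite !rpredM ?rpredX ?rpred_sum // => i _; rewrite rpredX ?rpredD ?rpred1.
have USV : U * (W * S) \in mspan c g2 (fun e => 0 < deg l e).
  apply: (@mspanM _ _ _ _ _ (fun e => deg l e == 1) (fun e => 0 <= deg l e)).
  - by move=> e e' /eqP; rewrite degD; lia.
  - by apply: mspan_mon; rewrite degl Uj.
  - by change (W * S \in laur_nneg c g2 l); rewrite rpredM ?nn ?w'j.
have [UV WV MV vV] : [/\ U \in laur c g2, W \in laur c g2, M \in laur c g2
    & v \in laur c g2] by split; apply: Vmon.
have SV : S \in laur c g2 by apply: mspan_laur S_nn.
clearbody S.
have W1V : 1 + W \in laur c g2 by rewrite rpredD ?rpred1 ?Vmon.
have gjV : g j \in laur c g2 by rewrite gjE rpredM ?Vmon.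
have AV : gj j \in laur c g2.
  by rewrite AE; apply: rpredM => //; rewrite rpredD ?rpred1 ?rpredM.
have M'V : M' \in laur c g2 by apply: Vmon.
have tV : t \in laur c g2 by apply: mspan_laur t_nn.
have DV : g k * g2 k \in laur c g2 by rewrite DE rpredM ?rpredD ?rpred1 ?Vmon.
(* Up to the unit [U], [g j] is [1 + W], homogeneous of degree 0, whereas [gj j] is a unit times 1
   plus terms of positive degree. *)
have regA y : y \in laur c g2 -> gj j * y / g j \in laur c g2 -> y / g j \in laur c g2.
  move=> yV h; rewrite gjE invfM mulrCA rpredM // ?VmonV //.
  apply: (laur_regular ind W0 _ USV yV).
    apply: mspanD; last by apply: mspan_mon; rewrite degl w'j.
    by rewrite -(mon0 g2); apply: mspan_mon; rewrite degl ffunE.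
  have -> : (1 + U * (W * S)) * y / (1 + W) = v^-1 * U * (gj j * y / g j).
    rewrite AE gjE; field.
    by rewrite W0 U0 mon_neq0.
  by apply: rpredM h; rewrite rpredM ?VmonV.
(* For [q > 0] the factor [1 + t] is 1 modulo [g j]. For [q = 0] the functional from [cop] gives [t]
   positive degree and [W] degree 0. *)
have regD y : y \in laur c g2 -> g k * g2 k * y / g j \in laur c g2 ->
    y / g j \in laur c g2.
  move=> yV; rewrite DE => h; have [q0|q0] := posnP q; last first.
    have -> : y / g j = M^-1 * (M * (1 + t) * y / g j) - t / g j * y.
      field.
      by rewrite gen_neq0 mon_neq0.
    rewrite tj; last by rewrite lt0n pq -lt0n.
    by apply: rpredB; [apply: rpredM h; apply: VmonV|rewrite !rpredM ?rpredX].
  have [|l' [lu lw]] := cop; first by rewrite wk q0.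
  have p0 : p = 0%N by apply/eqP; rewrite pq q0.
  have w'w : w' = w.
    apply/ffunP => i; have [->|ik] := eqVneq i k; first by rewrite w'k wk q0.
    by rewrite w'E // q0 addr0.
  have t2 : t = mon g2 (- u) by apply: mon2; rewrite ffunE ?uk ?uj ?p0.
  rewrite gjE invfM mulrCA rpredM // ?VmonV //.
  apply: (@laur_regular _ _ c _ g2 l' (1 + W) t) => //.
  - apply: mspanD; last by apply: mspan_mon; rewrite w'w lw.
    by rewrite -(mon0 g2); apply: mspan_mon; rewrite deg0.
  - by rewrite t2; apply: mspan_mon.
  have -> : (1 + t) * y / (1 + W) = M^-1 * U * (M * (1 + t) * y / g j).
    rewrite gjE; field.
    by rewrite W0 U0 mon_neq0.
  by apply: rpredM h; rewrite rpredM ?VmonV.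
have scV a : c a \in laur c g2 by apply: laur_scal.
have g1V i : i != j -> g1 i = g2 i by move=> /negPf ij; rewrite m2 ij.
have g1j : g1 j = g j by rewrite m1 (negPf jk).
have [N1 h1] : exists N, g j ^+ N * x \in laur c g2.
  apply: (laur_clear _ _ _ _ x1) => // i.
    by have [->|/g1V->] := eqVneq i j; rewrite ?g1j rpredM.
  have [->|/g1V->] := eqVneq i j; last by rewrite rpredM.
  by rewrite g1j divff ?rpred1 ?gen_neq0.
have gjk : gj k = g k by rewrite mj (negPf kj).
have gjV' i : i != k -> i != j -> gj i = g2 i.
  by move=> ik ij; rewrite mj (negPf ij) g2E.
set D := g k * g2 k in DV regD *.
have gkD : gj k = D / g2 k by rewrite gjk mulfK ?gen_neq0.
have gkDV : D / gj k = g2 k by rewrite gjk mulrC mulKf ?gen_neq0.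
clearbody D.
(* All variables of [gj] except [gj j] and [gj k] are variables of [g2], and [D / gj k] is [g2 k],
   so this product clears every denominator. *)
have [N2 h2] : exists N, (D * gj j) ^+ N * x \in laur c g2.
  apply: (laur_clear _ _ _ _ xj) => // [|i|i]; first by rewrite rpredM.
    have [->|ij] := eqVneq i j; first by rewrite !rpredM.
    have [->|ik] := eqVneq i k; last by rewrite (gjV' i) // !rpredM.
    by rewrite gkD !rpredM.
  have [->|ij] := eqVneq i j; first by rewrite mulfK ?gen_neq0.
  have [->|ik] := eqVneq i k; last by rewrite (gjV' i) // !rpredM.
  by rewrite mulrAC gkDV rpredM.
apply: (regular_saturated (gen_neq0 g j) _ _ _ h1 h2) => //; first by rewrite rpredM.
move=> y yV; rewrite -(mulrA _ (gj j)) => h; apply: (regA y yV).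
by apply: regD h; rewrite rpredM.
Qed.

(** Negating both [u] and [w] preserves the binomials and the mutation rule, so [w k] may be taken
    non-negative. *)
Lemma laur_exchange g g1 gj g2 k j u w x :
  k != j -> u k = 0 -> w j = 0 -> Num.sg (u j) = - Num.sg (w k) ->
  is_mutation g k u g1 -> is_mutation g j w gj ->
  is_mutation g1 j (mut_vec k u w) g2 -> independent c g2 ->
  (w k = 0 -> exists l, 0 < deg l u /\ deg l w = 0) ->
  x \in laur c g1 -> x \in laur c gj -> x \in laur c g2.
Proof.
move=> kj uk wj sgn m1 mj m2 ind cop.
have [wk|wk] := leP 0 (w k).
  apply: (laur_exchange_pos kj uk wj sgn wk m1 mj m2 ind) => /cop[l [lu lw]].
  by exists (- l); rewrite degN ![deg (- l) _]degC !degN opprK !(degC _ l) lw oppr0.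
apply: (@laur_exchange_pos g g1 gj g2 k j (- u) (- w)) => //.
- by rewrite ffunE uk oppr0.
- by rewrite ffunE wj oppr0.
- by rewrite !ffunE !sgrN sgn.
- by rewrite ffunE oppr_ge0 ltW.
- exact: is_mutationN.
- exact: is_mutationN.
- by rewrite mut_vecN; apply: is_mutationN.
- by rewrite ffunE => /eqP; rewrite oppr_eq0 lt_eqF.
Qed.

(** In the frame [g'] the variable [g k] is a unit times [1 + mon g' u], and grading by [u] itself
    puts [mon g' u] in positive degree. *)
Lemma mutation_pole_bounded g k u g' x : u k = 0 -> u != 0 ->
  is_mutation g k u g' -> independent c g' -> x \in laur c g' -> x != 0 ->
  exists B : nat, forall r, x / g k ^+ r \in laur c g' -> (r <= B)%N.
Proof.
move=> uk u0 mk ind xV x0.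
have [B hB] : exists B : nat, forall r y, y \in laur c g' ->
    x = (1 + mon g' u) ^+ r * y -> (r <= B)%N.
  apply: (laur_bounded (l := u) ind (mon_neq0 g' u) _ xV x0).
  by apply: mspan_mon; apply: deg_self_gt0.
exists B => r xr; pose U := mon g' (pos_part (- u) - basis_vec k).
have gk : g k = U * (1 + mon g' u) by apply: is_mutation_inv mk.
apply: (hB r (U ^+ r * (x / g k ^+ r))); first by rewrite rpredM ?rpredX ?laur_mon.
by rewrite mulrA -exprMn (mulrC _ U) -gk mulrC divfK // expf_neq0 ?gen_neq0.
Qed.

End Exchange.

(** * Extracting maximal monomial factors in an intersection of rings *)

Section LocalFactorization.
Variables (F : fieldType) (n : nat) (A : 'I_n -> F).
Variables (V0 : subringClosed F) (V : 'I_n -> subringClosed F).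
Hypothesis A_neq0 : forall k, A k != 0.
Hypothesis A_V0 : forall k, A k \in V0 /\ (A k)^-1 \in V0.
Hypothesis A_V : forall k i, i != k -> A i \in V k /\ (A i)^-1 \in V k.

Definition in_all (x : F) := x \in V0 /\ forall k, x \in V k.

Definition monomial (d : {ffun 'I_n -> nat}) := \prod_(i < n) A i ^+ d i.

Let other_factors k (d : {ffun 'I_n -> nat}) := \prod_(i < n | i != k) A i ^+ d i.

Lemma monomial_neq0 d : monomial d != 0.
Proof. by apply/prodf_neq0 => i _; rewrite expf_neq0. Qed.

Let other_factors_neq0 k d : other_factors k d != 0.
Proof. by apply/prodf_neq0 => i _; rewrite expf_neq0. Qed.

Let monomialE k d : monomial d = A k ^+ d k * other_factors k d.
Proof. by rewrite /monomial (bigD1 k). Qed.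

Let monomialV d : (monomial d)^-1 \in V0.
Proof.
by rewrite -prodfV rpred_prod // => i _; rewrite -exprVn rpredX; case: (A_V0 i).
Qed.

Let other_factorsV k d : other_factors k d \in V k /\ (other_factors k d)^-1 \in V k.
Proof.
split; rewrite -?prodfV rpred_prod // => i /A_V[ai ai']; first by rewrite rpredX.
by rewrite -exprVn rpredX.
Qed.

Lemma local_factorization_exists_uniq x : in_all x ->
  (forall k, exists B : nat, forall r, x / A k ^+ r \in V k -> (r <= B)%N) ->
  exists d, [/\ in_all (x / monomial d),
    forall k r, in_all (x / monomial d / A k ^+ r) -> r = 0%N &
    forall e y, x = monomial e * y -> in_all y ->
      (forall k r, in_all (y / A k ^+ r) -> r = 0%N) -> e = d].
Proof.
move=> [x0 xV] bounded.
have Emax k : exists dk, x / A k ^+ dk \in V k /\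
    forall r, x / A k ^+ r \in V k -> (r <= dk)%N.
  have [B hB] := bounded k.
  have E0 : exists r, x / A k ^+ r \in V k by exists 0%N; rewrite expr0 divr1.
  by case: (ex_maxnP E0 hB) => dk; exists dk.
have /choice[d0 d0P] := Emax.
pose d : {ffun 'I_n -> nat} := [ffun k => d0 k].
have dE k : x / A k ^+ d k \in V k by rewrite ffunE; case: (d0P k).
have dmax k r : x / A k ^+ r \in V k -> (r <= d k)%N.
  by rewrite ffunE; case: (d0P k) => _; apply.
exists d; split.
- split=> [|k]; first by rewrite rpredM.
  by rewrite (monomialE k) invfM mulrA rpredM //; case: (other_factorsV k d).
- move=> k r [_ /(_ k) h].
  suff /dmax : x / A k ^+ (d k + r) \in V k by lia.
  have -> : x / A k ^+ (d k + r) = x / monomial d / A k ^+ r * other_factors k d.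
    rewrite (monomialE k) exprD; field.
    by rewrite other_factors_neq0 !expf_neq0.
  by apply: rpredM h _; case: (other_factorsV k d).
move=> e y xe [y0 yV] ymax.
apply/ffunP => k; apply/eqP; rewrite eqn_leq; apply/andP; split.
  apply: dmax; have -> : x / A k ^+ e k = other_factors k e * y.
    by rewrite xe (monomialE k) mulrC -!mulrA mulKf // expf_neq0.
  by apply: rpredM (yV k); case: (other_factorsV k e).
(* Otherwise [y] is still divisible by [A k ^+ (d k - e k)]: in [V k] by the choice of [d k], in the
   other rings because [A k] is a unit there. *)
rewrite leqNgt; apply/negP => ek.
suff /ymax : in_all (y / A k ^+ (d k - e k)).
  by move/eqP; rewrite subn_eq0 leqNgt ek.
have AkV (X : subringClosed F) : (A k)^-1 \in X -> y \in X ->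
    y / A k ^+ (d k - e k) \in X.
  by move=> ? ?; rewrite rpredM // -exprVn rpredX.
split=> [|i]; first by apply: AkV => //; case: (A_V0 k).
have [->|ik] := eqVneq i k; last first.
  by apply: AkV => //; case: (@A_V i k); rewrite // eq_sym.
have -> : y / A k ^+ (d k - e k) = x / A k ^+ d k * (other_factors k e)^-1.
  rewrite xe (monomialE k) -{2}(subnK (ltnW ek)) exprD; field.
  by rewrite other_factors_neq0 !expf_neq0.
by apply: rpredM (dE k) _; case: (other_factorsV k e).
Qed.

End LocalFactorization.

(** * Seeds *)

(** Multiplying a relation by a monomial with large exponents makes all its exponents
    non-negative. *)
Lemma independent_nneg (K : comNzRingType) (F : fieldType) (c : {rmorphism K -> F})
    (I : finType) (g : frame F I) :
  (forall s : seq (K * {ffun I -> int}), (forall p i, p \in s -> 0 <= p.2 i) ->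
     \sum_(p <- s) c p.1 * mon g p.2 = 0 ->
     forall e : {ffun I -> int}, (forall i, 0 <= e i) ->
     \sum_(p <- s | p.2 == e) p.1 = 0) ->
  independent c g.
Proof.
move=> ind s s0 e.
(* Adding the pair [(0, e)] to the list makes the shift large enough for the tested vector [e] as
   well. *)
have [N sN] : exists N : nat, forall p i, p \in (0, e) :: s -> (`|p.2 i|%N <= N)%N.
  elim: ((0, e) :: s) => [|q r [N rN]]; first by exists 0%N.
  exists (maxn N (\max_i `|q.2 i|%N)) => p i; rewrite in_cons leq_max.
  case/orP => [/eqP->|/rN->//].
  by apply/orP; right; apply: (leq_bigmax (F := fun i => `|q.2 i|%N)).
pose sh : {ffun I -> int} := [ffun=> N%:Z].
have nn p i : p \in (0, e) :: s -> 0 <= (p.2 + sh) i.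
  by move=> /sN-/(_ i); rewrite !ffunE; move: (p.2 i) => y; lia.
pose s' := [seq (p.1, p.2 + sh) | p <- s].
have := ind s'; rewrite !big_map /=.
have /[swap]/[apply] : forall p i, p \in s' -> 0 <= p.2 i.
  by move=> p i /mapP[q qs ->] /=; apply: nn; rewrite in_cons qs orbT.
have -> : \sum_(p <- s) c p.1 * mon g (p.2 + sh) = 0.
  under eq_bigr => p _ do rewrite monD mulrA.
  by rewrite -mulr_suml s0 mul0r.
have esh i : 0 <= (e + sh) i by apply: (nn (0, e)); rewrite mem_head.
move=> /(_ erefl _ esh); rewrite big_map /= => h; rewrite -[RHS]h.
by apply: eq_bigl => p /=; rewrite (inj_eq (addIr _)).
Qed.

Lemma mpolyX_neq0 (R : nzRingType) n (mm : 'X_{1..n}) : 'X_[mm] != 0 :> {mpoly R[n]}.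
Proof.
apply/eqP => /(congr1 (mcoeff mm)); rewrite mcoeffX eqxx mcoeff0.
by apply/eqP; apply: oner_neq0.
Qed.

Section Seeds.
Variables (K : idomainType) (m n : nat).
Local Notation F := (ratfun K m n).
Local Notation I := ('I_m + 'I_n)%type.
Local Notation expo := {ffun I -> int}.
Implicit Types (A : {ffun 'I_n -> F}) (S : seed K m n) (e : expo).

Definition scal_rmorph : {rmorphism K -> F} :=
  (@tofrac {mpoly {mpoly K[m]}[n]} \o (@mpolyC n {mpoly K[m]} \o @mpolyC m K))%FUN.

Lemma scal_rmorphE a : scal_rmorph a = scal m n a. Proof. by []. Qed.

(** Counting the coefficient variables among the generators turns Laurent polynomials over the group
    ring into [K]-spans of monomials in [m + n] variables. *)
Definition gens A (i : I) : F :=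
  match i with inl z => coefvar K n z | inr j => A j end.

Definition coef_part e : trop m := [ffun z => e (inl z)].
Definition var_part e : {ffun 'I_n -> int} := [ffun j => e (inr j)].
Definition join_parts (a : trop m) (b : {ffun 'I_n -> int}) : expo :=
  [ffun i => match i with inl z => a z | inr j => b j end].

Lemma gens_neq0 A : free_generating_set A -> forall i, gens A i != 0.
Proof.
move=> [Afree _] [z|j] /=.
  by rewrite /coefvar tofrac_eq0 mpolyC_eq0 mpolyX_neq0.
(* If [A j] were zero, the polynomial ['X_j] would vanish at [A], against freeness. *)
apply/eqP => Aj; have /eqP : 'X_j = 0 :> {mpoly F[n]}.
  apply: Afree; last by rewrite mevalXU.
  move=> mm; rewrite mcoeffX; case: eqP => _; last by exists [::]; rewrite big_nil.
  exists [:: (1, trop_one m)]; rewrite big_seq1 /scal !mpolyC1 tofrac1 mul1r.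
  by rewrite /tropF big1 // => i _; rewrite ffunE expr0z.
by rewrite (negPf (mpolyX_neq0 _ _)).
Qed.

Definition seed_frame A (h : free_generating_set A) : frame F I :=
  Frame (gens_neq0 h).

Lemma mon_gens (g : frame F I) A e : g =1 gens A ->
  mon g e = tropF K n (coef_part e) * \prod_(j < n) A j ^ var_part e j.
Proof.
move=> gA; rewrite /mon big_sumType /=.
by congr (_ * _); apply: eq_bigr => i _; rewrite gA ffunE.
Qed.

Lemma laurentE A (g : frame F I) x : g =1 gens A ->
  laurent A x <-> x \in laur scal_rmorph g.
Proof.
move=> gA; split.
  move=> [s sKP ->]; rewrite big_seq; apply: mspan_sum => p /sKP[r ->].
  rewrite mulr_suml; apply: mspan_sum => q _; rewrite -mulrA.
  have -> : tropF K n q.2 * \prod_(i < n) A i ^ p.2 i =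
      mon g (join_parts q.2 p.2).
    rewrite (mon_gens _ gA); congr (tropF _ _ _ * _).
      by apply/ffunP => z; rewrite !ffunE.
    by apply: eq_bigr => i _; rewrite !ffunE.
  by rewrite -scal_rmorphE; apply: mspan_term.
move=> /asboolP[s _ ->].
exists [seq (scal m n p.1 * tropF K n (coef_part p.2), var_part p.2) | p <- s].
  move=> p /mapP[q _ ->] /=; exists [:: (q.1, coef_part q.2)].
  by rewrite big_seq1.
by rewrite big_map; apply: eq_bigr => p _; rewrite (mon_gens _ gA) mulrA.
Qed.

Lemma inKP_sum (J : Type) (r : seq J) (P : pred J) (f : J -> F) :
  (forall j, inKP (f j)) -> inKP (\sum_(j <- r | P j) f j).
Proof.
move=> h; apply: (big_ind (@inKP K m n)) => //.
  by exists [::]; rewrite big_nil.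
by move=> x y [s ->] [s' ->]; exists (s ++ s'); rewrite big_cat.
Qed.

(** Freeness separates the monomials in the cluster variables; within each of them, the monomials in
    the coefficient variables are independent over [K]. Non-negative exponents keep both stages
    inside polynomial rings. *)
Lemma free_independent A (g : frame F I) : g =1 gens A ->
  free_generating_set A -> independent scal_rmorph g.
Proof.
move=> gA [Afree _]; apply: independent_nneg => s s_nn s0 e e_nn.
pose am e : 'X_{1..m} := [multinom `|e (inl i)|%N | i < m].
pose bm e : 'X_{1..n} := [multinom `|e (inr i)|%N | i < n].
pose k (p : K * expo) : F := scal m n p.1 * tropF K n (coef_part p.2).
have kE p : p \in s -> k p = tofrac ((p.1 *: 'X_[am p.2])%:MP).
  move=> ps; rewrite -mul_mpolyC !mpolyCM tofracM; congr (_ * _).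
  rewrite mpolyXE_id rmorph_prod rmorph_prod; apply: eq_bigr => z _.
  by rewrite !rmorphXn /= /coefvar ffunE mnmE exprnP gez0_abs ?s_nn.
pose P := \sum_(p <- s) k p *: 'X_[bm p.2].
have P0 : P = 0.
  apply: Afree => [mm|].
    rewrite raddf_sum; apply: inKP_sum => q /=; rewrite mcoeffZ mcoeffX.
    case: eqP => _; rewrite ?mulr0 ?mulr1.
      by exists [:: (q.1, coef_part q.2)]; rewrite big_seq1.
    by exists [::]; rewrite big_nil.
  rewrite -[RHS]s0 raddf_sum [LHS]big_seq [RHS]big_seq; apply: eq_bigr => p ps /=.
  rewrite mevalZ mevalX (mon_gens _ gA) mulrA; congr (_ * _).
  by apply: eq_bigr => j _; rewrite mnmE ffunE exprnP gez0_abs ?s_nn.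
pose Q := \sum_(p <- s | bm p.2 == bm e) p.1 *: 'X_[am p.2] : {mpoly K[m]}.
have Q0 : Q = 0.
  apply/eqP; rewrite -(mpolyC_eq0 n) -tofrac_eq0 !raddf_sum /=.
  have := congr1 (mcoeff (bm e)) P0; rewrite mcoeff0 raddf_sum /= => h.
  rewrite -[X in _ == X]h big_mkcond [X in X == _]big_seq [X in _ == X]big_seq.
  apply/eqP/eq_bigr => p ps; rewrite mcoeffZ mcoeffX -kE //.
  by case: eqP; rewrite ?mulr1 ?mulr0.
have := congr1 (mcoeff (am e)) Q0; rewrite mcoeff0 raddf_sum /= => h.
rewrite -[RHS]h big_mkcond [RHS]big_mkcond /= [LHS]big_seq [RHS]big_seq.
apply: eq_bigr => p ps; rewrite mcoeffZ mcoeffX.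
have [->|pe] := eqVneq p.2 e; first by rewrite !eqxx mulr1.
case: eqP => // hb; case: eqP => ha; rewrite ?mulr0 //.
case/eqP: pe; apply/ffunP => -[z|j].
  have /mnmP/(_ z) := ha; rewrite !mnmE => h'.
  by rewrite -[LHS]gez0_abs ?s_nn // h' gez0_abs.
have /mnmP/(_ j) := hb; rewrite !mnmE => h'.
by rewrite -[LHS]gez0_abs ?s_nn // h' gez0_abs.
Qed.

(** This is column [k] of the extended exchange matrix, with coefficient rows under [inl] and matrix
    rows under [inr]. *)
Definition exchange_vec S k : expo :=
  [ffun i => match i with inl z => coefs S k z | inr j => exmat S j k end].

(** In the tropical semifield the two coefficients of the binomial have as exponents the positive
    and the negative part of those of [coefs S k], exactly as the cluster variables do. *)
Lemma exchange_binomialE (g : frame F I) S k : g =1 gens (cluster S) ->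
  exchange_binomial S k = exch_binom g (exchange_vec S k).
Proof.
move=> gA; rewrite /exchange_binomial /exch_binom !(mon_gens _ gA).
congr (_ * _ + _ * _).
- by congr tropF; apply/ffunP => z; rewrite !ffunE; move: (coefs S k z) => x; lia.
- rewrite big_mkcond; apply: eq_bigr => j _; rewrite !ffunE.
  by case: ltP; rewrite ?expr0z.
- by congr tropF; apply/ffunP => z; rewrite !ffunE; move: (coefs S k z) => x; lia.
rewrite big_mkcond; apply: eq_bigr => j _; rewrite !ffunE -oppr_gt0.
by case: ltP; rewrite ?expr0z.
Qed.

Lemma mutate_is_mutation (g g' : frame F I) S k : g =1 gens (cluster S) ->
  g' =1 gens (cluster (mutate k S)) ->
  is_mutation g (inr k) (exchange_vec S k) g'.
Proof.
move=> gA gA' [z|j]; rewrite gA' /= ?gA // ffunE; case: eqP => [->|].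
  by rewrite (exchange_binomialE _ gA) eqxx.
by move=> jk; rewrite ifN //; apply: contra_not_neq jk => -[].
Qed.

(** The tropical rule adds [x * max(b, 0) - min(x, 0) * b] to an exponent, which equals the matrix
    increment [sgn(x) * max(x * b, 0)]. *)
Lemma exchange_vec_mutate S k j : j != k ->
  exchange_vec (mutate k S) j =
  mut_vec (inr k) (exchange_vec S k) (exchange_vec S j).
Proof.
move=> jk; apply/ffunP => -[z|i]; rewrite !ffunE /=.
  rewrite (negPf jk) !ffunE; move: (coefs S k z) (coefs S j z) (exmat S k j).
  by move=> x y b; nia.
by rewrite mxE (negPf jk) orbF (inj_eq (@inr_inj _ _)) ?ffunE; case: eqP.
Qed.

Lemma exchange_vec_mutate_same S k :
  exchange_vec (mutate k S) k = - exchange_vec S k.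
Proof.
apply/ffunP => -[z|i]; rewrite !ffunE /= ?eqxx ?ffunE; first by rewrite mulrN1.
by rewrite mxE eqxx orbT.
Qed.

Lemma skew_symmetrizable_sg (B : 'M[int]_n) i j : skew_symmetrizable B ->
  Num.sg (B i j) = - Num.sg (B j i).
Proof.
move=> [d d_gt0 /matrixP/(_ j i)]; rewrite !mxE.
have entry a b : \sum_j0 (diag_mx d) a j0 * B j0 b = d 0 a * B a b.
  by have /matrixP/(_ a b) := mul_diag_mx d B; rewrite [LHS]mxE [RHS]mxE.
rewrite !entry => /(congr1 Num.sg).
by rewrite sgrN !sgrM !(gtr0_sg (d_gt0 _)) !mul1r.
Qed.

Lemma skew_symmetrizable_diag (B : 'M[int]_n) i : skew_symmetrizable B ->
  B i i = 0.
Proof.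
by move=> /(skew_symmetrizable_sg i i)/eqP; rewrite -subr_eq0 opprK; lia.
Qed.

(** * Column rank of the extended exchange matrix under mutation *)

Definition columns_free S := forall y : 'I_n -> int,
  (forall i, \sum_j exchange_vec S j i * y j = 0) -> forall j, y j = 0.

Lemma full_rank_columns_free S : full_rank S -> columns_free S.
Proof.
move=> S_rank y y0 j.
pose B : 'M[rat]_(n + m, n) := map_mx intr (extended_exmat S).
have /row_fullP[C CB] : row_full B by apply/eqP.
pose Y : 'cV[rat]_n := \col_j (y j)%:~R.
have BY : B *m Y = 0.
  apply/matrixP => i i0; rewrite !mxE.
  pose e : I := match split i with inl a => inr a | inr z => inl z end.
  have /(congr1 (fun x : int => x%:~R : rat)) := y0 e.
  rewrite rmorph0 rmorph_sum /= => h; rewrite -[RHS]h; apply: eq_bigr => j' _.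
  rewrite rmorphM /= !mxE ffunE /e; case: (split i) => // z.
  by rewrite mxE.
have /matrixP/(_ j 0) : Y = 0 by rewrite -[Y]mul1mx -CB -mulmxA BY mulmx0.
by rewrite !mxE => /eqP; rewrite intr_eq0 => /eqP.
Qed.

(** Off row [k], mutation adds [max(b j, 0) * ui + max(- ui, 0) * b j] to the entry of column [j] in
    row [i]. The second summand vanishes on [y] by row [k]; the first is a column operation, undone
    by [z]. *)
Lemma columns_free_mutate S k : skew_symmetrizable (exmat S) ->
  columns_free S -> columns_free (mutate k S).
Proof.
move=> sk S_free y y0.
pose b j := exchange_vec S j (inr k).
have bk : b k = 0 by rewrite /b ffunE skew_symmetrizable_diag.
have y'0 : \sum_j b j * y j = 0.
  have /eqP := y0 (inr k); rewrite -oppr_eq0 -sumrN => /eqP h; rewrite -[RHS]h.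
  apply: eq_bigr => j _; have [->|jk] := eqVneq j k.
    by rewrite exchange_vec_mutate_same ffunE -/(b k) bk oppr0 !mul0r oppr0.
  by rewrite exchange_vec_mutate // !ffunE eqxx mulNr opprK /b ffunE.
pose z j := if j == k then - y k + \sum_j' Num.max (b j') 0 * y j' else y j.
have zj j : j != k -> z j = y j by rewrite /z => /negPf->.
have bz : \sum_j b j * z j = 0.
  rewrite -[RHS]y'0; apply: eq_bigr => j _; have [->|/zj->//] := eqVneq j k.
  by rewrite bk !mul0r.
have z0 : forall j, z j = 0.
  apply: S_free => i; have [->//|ik] := eqVneq i (inr k).
  pose ui := exchange_vec S k i.
  have eq j : exchange_vec S j i * z j = exchange_vec (mutate k S) j i * y j
      - ui * (Num.max (b j) 0 * y j) - Num.max (- ui) 0 * (b j * y j)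
      + (if j == k then ui * \sum_j' Num.max (b j') 0 * y j' else 0).
    have [->|jk] := eqVneq j k.
      rewrite exchange_vec_mutate_same bk [fun_of_fin (- _) i]ffunE -/ui /z eqxx.
      by move: (\sum_j' _) => x; rewrite !mul0r mulr0 mulrDr; lia.
    rewrite exchange_vec_mutate // [mut_vec _ _ _ i]ffunE (negPf ik) zj // -/(b j) -/ui.
    move: (exchange_vec S j i) (b j) (y j) ui => x1 x2 x3 x4.
    rewrite addr0 !mulrA -!mulrBl; congr (_ * _); nia.
  rewrite (eq_bigr _ (fun j _ => eq j)) big_split -big_mkcond big_pred1_eq /=.
  rewrite !big_split /= y0 !sumrN -!mulr_sumr y'0 mulr0.
  by rewrite oppr0 addr0 add0r addNr.
have y_eq0 j : j != k -> y j = 0 by move=> /zj<-.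
move=> j; have [->|/y_eq0//] := eqVneq j k.
(* With [y] zero off [k], the sum in [z k] retains only the term of [b k = 0], so [z k = 0] gives
   [y k = 0]. *)
have := z0 k; rewrite /z eqxx big1 ?addr0 => [|j' _].
  by move/eqP; rewrite oppr_eq0 => /eqP.
have [->|/y_eq0->] := eqVneq j' k; last by rewrite mulr0.
by rewrite bk mul0r.
Qed.

Lemma columns_free_neq0 S k : columns_free S -> exchange_vec S k != 0.
Proof.
move=> S_free; apply/eqP => k0.
pose y j : int := (j == k)%:Z.
have y0 i : \sum_j exchange_vec S j i * y j = 0.
  rewrite (bigD1 k) //= k0 ffunE mul0r add0r big1 // => j /negPf jk.
  by rewrite /y jk mulr0.
by have := S_free y y0 k; rewrite /y eqxx.
Qed.

(* The functional is the scalar product with the component of the first column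
   orthogonal to the second one. *)
Lemma columns_free_separated S k j : k != j -> columns_free S ->
  exists l, 0 < deg l (exchange_vec S k) /\ deg l (exchange_vec S j) = 0.
Proof.
move=> kj S_free; set u := exchange_vec S k; set w := exchange_vec S j.
have ww : 0 < deg w w by apply/deg_self_gt0/columns_free_neq0.
pose z : expo := [ffun i => deg w w * u i - deg u w * w i].
have zi i : z i = deg w w * u i - deg u w * w i by rewrite [LHS]ffunE.
have zE e : deg z e = deg w w * deg u e - deg u w * deg w e.
  rewrite /deg !mulr_sumr -sumrB; apply: eq_bigr => i _.
  by rewrite zi mulrBl !mulrA.
have zw : deg z w = 0 by rewrite zE mulrC subrr.
have z0 : z != 0.
  apply/eqP => z0.
  (* A zero [z] would be a relation between the two columns whose first coefficient [deg w w] is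
     positive. *)
  pose y a := if a == k then deg w w else if a == j then - deg u w else 0.
  have y0 i : \sum_a exchange_vec S a i * y a = 0.
    have := zi i; rewrite z0 [LHS]ffunE => h; rewrite [RHS]h.
    rewrite (bigD1 k) //= (bigD1 j) /=; last by rewrite eq_sym.
    rewrite big1 => [|a /andP[/negPf ak /negPf aj]]; last first.
      by rewrite /y ak aj mulr0.
    rewrite /y !eqxx eq_sym (negPf kj) addr0 mulrN -/u -/w.
    by rewrite mulrC [w i * _]mulrC.
  by have := S_free y y0 k; rewrite /y eqxx => h; rewrite h in ww.
exists z; split=> //; have := deg_self_gt0 z0; rewrite {1}zE -/u -/w.
by rewrite !(degC _ z) zw mulr0 subr0 pmulr_rgt0.
Qed.

End Seeds.

(** * Seed patterns *)

Section Tree.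
Variable n : nat.
Implicit Types (t : tree n) (k : 'I_n).

Lemma tree_edgeC k t t' : tree_edge k t t' = tree_edge k t' t.
Proof. exact: orbC. Qed.

(** Deleting last letters joins every vertex to the empty word, and edges can be crossed both
    ways. *)
Lemma tree_connected (Q : tree n -> Prop) :
  (forall k t t', tree_edge k t t' -> Q t -> Q t') -> forall t t', Q t -> Q t'.
Proof.
move=> Qe; pose root : tree n := exist _ [::] isT.
have Qroot t : Q t <-> Q root.
  case: t => w; elim/last_ind: w => [|w k IHw] ws.
    by split; congr Q; apply: val_inj.
  have ws' : sorted (fun i j : 'I_n => i != j) w.
    by move: ws; rewrite -cats1 => /cat_sorted2[].
  rewrite -(IHw ws'); split; apply: (Qe k); first by rewrite /tree_edge /= eqxx orbT.
  by rewrite /tree_edge /= eqxx.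
by move=> t t'; rewrite (Qroot t) (Qroot t').
Qed.

Lemma tree_neighbor k t : exists t', tree_edge k t t'.
Proof.
case: t => -[|a w] ws; first by exists (exist _ [:: k] isT); rewrite /tree_edge /= eqxx.
have [lk|lk] := eqVneq (last a w) k.
  have ws' : sorted (fun i j : 'I_n => i != j) (belast a w).
    by move: ws; rewrite lastI -cats1 => /cat_sorted2[].
  exists (exist (fun w : seq 'I_n => sorted (fun i j => i != j) w) _ ws').
  by rewrite /tree_edge /= -lk -lastI eqxx orbT.
have ws' : sorted (fun i j : 'I_n => i != j) (rcons (a :: w) k).
  by rewrite /= rcons_path lk andbT.
exists (exist (fun w : seq 'I_n => sorted (fun i j => i != j) w) _ ws').
by rewrite /tree_edge /= eqxx.
Qed.

(** If one edge appended [k] and the other removed it, some word would end in two letters [k]. *)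
Lemma tree_neighbor_uniq k t t1 t2 :
  tree_edge k t t1 -> tree_edge k t t2 -> t1 = t2.
Proof.
have no_kk w : ~ sorted (fun i j : 'I_n => i != j) (rcons (rcons w k) k).
  by rewrite -!cats1 -catA => /cat_sorted2[_]; rewrite /= eqxx.
move=> /orP[]/eqP e1 /orP[]/eqP e2; apply: val_inj.
- by rewrite e1 e2.
- by case: (no_kk (val t2)); rewrite -e2 -e1; apply: valP.
- by case: (no_kk (val t1)); rewrite -e1 -e2; apply: valP.
by move: e2; rewrite e1 => /rcons_inj[].
Qed.

End Tree.

Section Pattern.
Variables (K : idomainType) (m n : nat) (S : tree n -> seed K m n).
Hypothesis S_pattern : seed_pattern S.
Local Notation F := (ratfun K m n).
Local Notation I := ('I_m + 'I_n)%type.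
Implicit Types (t : tree n) (k : 'I_n) (x : F).

Definition frame_at t : frame F I := seed_frame (S_pattern.1 t).2.

Lemma frame_atE t : frame_at t =1 gens (cluster (S t)). Proof. by []. Qed.

Lemma frame_at_independent t : independent (scal_rmorph K m n) (frame_at t).
Proof. exact: free_independent (frame_atE t) (S_pattern.1 t).2. Qed.

Lemma laurent_frame t x :
  laurent (cluster (S t)) x <-> x \in laur (scal_rmorph K m n) (frame_at t).
Proof. exact: laurentE. Qed.

Lemma exchange_vec_diag t k : exchange_vec (S t) k (inr k) = 0.
Proof. by rewrite ffunE skew_symmetrizable_diag //; case: (S_pattern.1 t). Qed.

Lemma frame_at_mutation k t t' : tree_edge k t t' ->
  is_mutation (frame_at t) (inr k) (exchange_vec (S t) k) (frame_at t').
Proof.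
move=> tt'; apply: mutate_is_mutation => // i.
by rewrite frame_atE (S_pattern.2 _ _ _ tt').
Qed.

Lemma columns_free_at t0 t : full_rank (S t0) -> columns_free (S t).
Proof.
move=> /full_rank_columns_free.
apply: (tree_connected (Q := fun t => columns_free (S t))).
move=> k {}t t' /(S_pattern.2 _ _ _)->; apply: columns_free_mutate.
by case: (S_pattern.1 t).
Qed.

Lemma starfish t0 x : full_rank (S t0) -> laurent (cluster (S t0)) x ->
  (forall k t, tree_edge k t0 t -> laurent (cluster (S t)) x) -> upper S x.
Proof.
move=> S_rank x0 xk t.
have S_free t' : columns_free (S t') by apply: columns_free_at S_rank.
(* The neighbors belong to the invariant because a vertex beyond [t1] is handled through [t1]
   together with another neighbor of [t]. *)
pose Q t := laurent (cluster (S t)) x /\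
  forall k t', tree_edge k t t' -> laurent (cluster (S t')) x.
suff : Q t by case.
apply: (tree_connected (Q := Q)) (conj x0 xk) => {x0 xk}k {}t t1 tt1 [xt xn].
split=> [|j t2 t12]; first exact: xn tt1.
(* Crossing the edge [k] a second time leads back to [t]. *)
have [jk|jk] := eqVneq j k.
  rewrite jk in t12; rewrite tree_edgeC in tt1.
  by rewrite -(tree_neighbor_uniq tt1 t12).
have [tj ttj] := tree_neighbor j t.
have kj : inr k != inr j :> I by rewrite (inj_eq (@inr_inj _ _)) eq_sym.
apply/laurent_frame; apply: (laur_exchange (g := frame_at t) kj
  (exchange_vec_diag t k) (exchange_vec_diag t j)).
- rewrite !ffunE; apply: skew_symmetrizable_sg; exact: (S_pattern.1 t).1.
- exact: frame_at_mutation tt1.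
- exact: frame_at_mutation ttj.
- have := frame_at_mutation t12.
  by rewrite {1}(S_pattern.2 _ _ _ tt1) exchange_vec_mutate.
- exact: frame_at_independent.
- by move=> _; apply: columns_free_separated => //; rewrite eq_sym.
- exact/laurent_frame/(xn _ _ tt1).
exact/laurent_frame/(xn _ _ ttj).
Qed.

Lemma pole_order_bounded t0 t k x : full_rank (S t0) -> tree_edge k t0 t ->
  x != 0 -> laurent (cluster (S t)) x ->
  exists B, forall r, laurent (cluster (S t)) (x / cluster (S t0) k ^+ r) ->
    (r <= B)%N.
Proof.
move=> S_rank tt' x0 /laurent_frame xt.
have u0 : exchange_vec (S t0) k != 0.
  by apply: columns_free_neq0; apply: columns_free_at S_rank.
have [B hB] := mutation_pole_bounded (exchange_vec_diag t0 k) u0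
  (frame_at_mutation tt') (@frame_at_independent t) xt x0.
by exists B => r /laurent_frame/hB.
Qed.

(** Since [x] lies in the upper cluster algebra, exponent 0 is always admissible; if it is the only
    one, it is the maximum, which excludes [None]. *)
Lemma vpairing_eq0 t k x : upper S x ->
  vpairing S t k x = Some 0%N <->
  forall r, upper S (x / cluster (S t) k ^+ r) -> r = 0%N.
Proof.
move=> Ux; rewrite /vpairing; case: pselect => [h|h]; split=> //.
- case: (cid _) => s [/= _ smax] [s0] r /smax; rewrite s0; by case: r.
- by case: (cid _) => s [/= Us _] /(_ _ Us)->.
move=> x0; case: h; exists 0%N; split=> [|r /x0->//].
by rewrite expr0 divr1.
Qed.

End Pattern.

(** * Existence and uniqueness of the local factorization *)

Theorem theorem3p7 (K : idomainType) (K_factorial : factorial_domain K)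
    (K_char0 : [pchar K] =i pred0) (m n : nat)
    (S : tree n -> seed K m n) (S_pattern : seed_pattern S)
    (no_invertible_binomial :
       forall t k, ~ invertibleKP (exchange_binomial (S t) k))
    (t0 : tree n) (S_full_rank : full_rank (S t0))
    (M : ratfun K m n) (M_upper : upper S M) (M_neq0 : M != 0) :
  exists! NL : ratfun K m n * ratfun K m n, local_factorization S t0 M NL.
Proof.
pose A k := cluster (S t0) k.
have A0 k : A k != 0 by apply: (gen_neq0 (frame_at S_pattern t0) (inr k)).
have /choice[nb nbP] := fun k => tree_neighbor k t0.
pose V t := laur (scal_rmorph K m n) (frame_at S_pattern t).
have VP t x : laurent (cluster (S t)) x <-> x \in V t by apply: laurent_frame.
(* The starfish property leaves only [t0] and its [n] neighbors to test, the setting in which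
   maximal monomial factors were extracted. *)
have mem_upper x : upper S x <-> x \in V t0 /\ forall k, x \in V (nb k).
  split=> [Ux|[x0 xk]].
    by split=> [|k]; [apply: (VP _ _).1 (Ux t0)|apply: (VP _ _).1 (Ux (nb k))].
  apply: (starfish S_pattern S_full_rank ((VP _ _).2 x0)) => k t tk.
  rewrite (tree_neighbor_uniq tk (nbP k)); exact: (VP _ _).2 (xk k).
have AV0 k : A k \in V t0 /\ (A k)^-1 \in V t0.
  rewrite -[A k]/(frame_at S_pattern t0 (inr k)) -mon_basis_vec -monN.
  by split; apply: laur_mon.
have AV k i : i != k -> A i \in V (nb k) /\ (A i)^-1 \in V (nb k).
  move=> ik; have <- : frame_at S_pattern (nb k) (inr i) = A i.
    by rewrite (frame_at_mutation S_pattern (nbP k)) ifN //.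
  by rewrite -mon_basis_vec -monN; split; apply: laur_mon.
have UP x : upper S x <-> in_all (V t0) (V \o nb) x by exact: mem_upper.
have bounded k : exists B, forall r, M / A k ^+ r \in V (nb k) -> (r <= B)%N.
  have [B hB] := pole_order_bounded S_pattern S_full_rank (nbP k) M_neq0
    (M_upper (nb k)).
  by exists B => r /VP/hB.
have [d [UL Lmax d_uniq]] :=
  local_factorization_exists_uniq A0 AV0 AV ((UP M).1 M_upper) bounded.
have {}UL := (UP _).2 UL.
exists (monomial A d, M / monomial A d); split.
  split; [|by exists d|exact: UL|].
    by rewrite [RHS]mulrC [RHS](divfK (monomial_neq0 A0 d)).
  by move=> k; apply: (vpairing_eq0 t0 k UL).2 => r /UP; apply: Lmax.
move=> [N L] [/= ML [e Ne] UL' Lk].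
have {}Ne : N = monomial A e := Ne.
have ed : e = d.
  apply: (d_uniq e L _ ((UP L).1 UL')) => [|k r /UP].
    by rewrite ML Ne.
  exact: (vpairing_eq0 t0 k UL').1 (Lk k) r.
have NE : N = monomial A d by rewrite Ne ed.
by rewrite ML NE [X in (_, X)]mulrC [X in (_, X)](mulKf (monomial_neq0 A0 d)).
Qed.
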